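(* Let $C\subseteq\mathbb{R}$ be the attractor of an iterated function system $$f_j(y)=\frac{p_j}{q_j}y+\frac{r_j}{q_j},\qquad 1\leq j\leq J,\quad J\geq 2,$$ with $p_j\in\{-1,1\}$, $r_j\in\mathbb{Z}$ and integers $q_j\geq 2$, that satisfies the open set condition. Denote the Hausdorff dimension of $C$ by $\Delta$. Then for sufficiently large $\rho=\rho(C)$ we have $$d\Big(C,\frac{p}{q}\Big)>e^{-\rho q^{\Delta}}$$ for every $p/q\in\mathbb{Q}\setminus C$. In the special case of a missing digit Cantor set $C=C_{b,W}$, we have $\Delta=\log|W|/\log b$ and the inequality $$d\Big(C,\frac{p}{q}\Big)>\frac{b^{-(2b)^{\Delta}q^{\Delta}}}{2q}$$ holds for every $p/q\in\mathbb{Q}\setminus C$. In particular, for every $\xi\in C_{b,W}$ and any $\delta>(2b)^{\Delta}$, the inequality $$\Big|\xi-\frac{p}{q}\Big|\leq b^{-\delta q^{\Delta}}$$ has only finitely many solutions $p/q\in\mathbb{Q}\setminus C$.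
   Context: Rationals are written $p/q$ with $p\in\mathbb{Z}$, $q\in\mathbb{N}$, $q\geq1$. The attractor of a finite family (IFS) of contractions is the unique nonempty compact set $C$ with $\bigcup_jf_j(C)=C$. The IFS satisfies the open set condition if there is a nonempty bounded open set $O\subseteq\mathbb{R}$ with $f_j(O)\subseteq O$ for all $j$ and $f_i(O)\cap f_j(O)=\emptyset$ for $i\neq j$. For $A,B\subseteq\mathbb{R}$, $d(A,B)=\inf\{|a-b|:a\in A,b\in B\}$, and $d(C,x)=d(C,\{x\})$. For an integer $b\geq 3$ and a digit set $W\subseteq\{0,1,\ldots,b-1\}$ with $2\leq|W|\leq b-1$, the missing digit Cantor set $C_{b,W}$ is the set of real numbers in $[0,1]$ having a base $b$ expansion $\sum_{j\geq1}w_jb^{-j}$ with all digits $w_j\in W$. Here $e$ is Euler's number. *)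

(* Defs.v *)
From HB Require Import structures.
From mathcomp Require Import all_boot all_order all_algebra.
From mathcomp Require Import all_classical all_reals all_analysis.

Set Implicit Arguments.
Unset Strict Implicit.
Unset Printing Implicit Defensive.

Import Order.TTheory GRing.Theory Num.Theory.
Import numFieldNormedType.Exports.

Local Open Scope classical_set_scope.
Local Open Scope ring_scope.

Definition set_dist (R : realType) (A B : set R) : R :=
  inf [set `|a - b| | a in A & b in B].

(* The point 0 is adjoined so that the empty set has diameter 0, not -oo. *)
Definition diam (R : realType) (A : set R) : \bar R :=
  ereal_sup (0%E |` [set (`|x - y|)%:E | x in A & y in A]).

Definition hausdorff_content (R : realType) (s e : R) (A : set R) : \bar R :=
  ereal_inf [set (\sum_(0 <= i <oo) poweR (diam (U i)) s)%E |
    U in [set U : (set R)^nat |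
      A `<=` \bigcup_i U i /\ forall i, (diam (U i) <= e%:E)%E]].

Definition hausdorff_measure (R : realType) (s : R) (A : set R) : \bar R :=
  ereal_sup [set hausdorff_content s e A | e in [set e : R | 0 < e]].

(* Omitting s = 0 does not change the infimum and avoids the convention
   for 0 to the power 0. *)
Definition hausdorff_dim (R : realType) (A : set R) : \bar R :=
  ereal_inf [set s%:E |
    s in [set s : R | 0 < s /\ hausdorff_measure s A = 0%E]].

Definition is_attractor (R : realType) (J : nat) (f : 'I_J -> R -> R)
    (C : set R) : Prop :=
  [/\ C !=set0, compact C & \bigcup_j (f j @` C) = C].

Definition open_set_condition (R : realType) (J : nat) (f : 'I_J -> R -> R) :
    Prop :=
  exists O : set R,
    [/\ O !=set0, bounded_set (O : set R^o), open O,
        forall j, f j @` O `<=` O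
      & forall i j, i != j -> (f i @` O) `&` (f j @` O) = set0].

Definition ifs_map (R : realType) (J : nat) (p r : 'I_J -> int)
    (q : 'I_J -> nat) (j : 'I_J) (y : R) : R :=
  (p j)%:~R / (q j)%:R * y + (r j)%:~R / (q j)%:R.

(* The digit sequence is indexed from 0: w i is the digit of weight
   b ^ -(i+1). *)
Definition missing_digit_set (R : realType) (b : nat) (W : {set 'I_b}) :
    set R :=
  [set x : R | 0 <= x <= 1 /\
    exists w : nat -> 'I_b, (forall i, w i \in W) /\
      series (fun i => (w i)%:R / b%:R ^+ i.+1 : R) @ \oo --> x].

(* Main.v *)
(** The inverse of each map sends a rational with denominator v to a rational
    with denominator v and expands distances by at most Q = max q_j. Starting
    from u/v outside C and following the coding of a nearest point c of C one
    gets rationals of denominator v whose distance to C at time n is at most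
    Q^n |u/v - c|. They are pairwise distinct: a repetition would be a fixed
    point of a composition of the maps, hence lie in C. As long as the distance
    is at most 1/(8v), they lie near points of C that are 3/(4v)-separated, and
    there are only O(v^Delta) such points, so that |u/v - c| is at least
    Q^(-O(v^Delta)) / (8v).

    The packing bound needs no measure on C: more than (const * v)^Delta
    separated points would give as many maps of C onto disjoint small pieces of
    itself, and for maps g_i with separated images, contracting by at most a
    factor c where #I c^t >= 1, every finite cover satisfies sum diam^t >= d^t. This is
    proved by induction on the number of sets: either a set has diameter at
    least the gap d, or each set meets at most one image g_i(C), and the cover
    splits into strictly smaller covers of copies of C. The open set condition
    only serves to exclude that C is a single point. *)
Require Import Defs.
From HB Require Import structures.
From mathcomp Require Import all_boot all_order all_algebra.
From mathcomp Require Import all_classical all_reals all_analysis.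
From mathcomp Require Import finmap ring lra zify.

Set Implicit Arguments.
Unset Strict Implicit.
Unset Printing Implicit Defensive.

Import Order.TTheory GRing.Theory Num.Theory.
Import numFieldNormedType.Exports.

Local Open Scope classical_set_scope.
Local Open Scope ring_scope.

(** * Hausdorff dimension of self-similar sets *)

Lemma powR_le_base (R : realType) (t x y : R) :
  0 <= t -> 0 <= x -> x <= y -> x `^ t <= y `^ t.
Proof.
by move=> t0 x0 xy; apply: ge0_ler_powR; rewrite ?nnegrE// (le_trans x0).
Qed.

Lemma powR_lt_base (R : realType) (t x y : R) :
  0 < t -> 0 <= x -> x < y -> x `^ t < y `^ t.
Proof.
by move=> t0 x0 xy; apply: gt0_ltr_powR; rewrite ?nnegrE// (le_trans x0)// ltW.
Qed.

(** Diameters enter only through bounds [r i], and [U] and [r] vary in the induction on [#|S|]: seen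
    through [g j], the cover becomes the preimages of the sets in [T j], with bounds [r i / c]. *)
Lemma finite_cover_lower_bound (R : realType) (I : finType) (E : set R)
    (g : I -> R -> R) (c d t : R) :
    E !=set0 -> (forall i x, E x -> E (g i x)) -> 0 < c < 1 -> 0 < t ->
    (forall i x y, E x -> E y -> c * `|x - y| <= `|g i x - g i y|) ->
    (forall i j x y, i != j -> E x -> E y -> d <= `|g i x - g j y|) ->
    0 < d -> 1 <= #|I|%:R * c `^ t ->
  forall (n : nat) (S : {set 'I_n}) (U : 'I_n -> set R) (r : 'I_n -> R),
    (forall i x y, U i x -> U i y -> `|x - y| <= r i) ->
    (forall i, 0 <= r i) ->
    (forall x, E x -> exists2 i, i \in S & U i x) ->
  d `^ t <= \sum_(i in S) r i `^ t.
Proof.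
move=> [e Ee] gE /andP[c0 c1] t0 gc gd d0 Ict n S.
have ct1 : c `^ t < 1.
  by have := powR_lt_base t0 (ltW c0) c1; rewrite powR1.
(* As c^t < 1, the hypothesis on [#|I|] forces two maps; a set meeting another piece is then missing
   from [T j], so [T j] is smaller than [S]. *)
have cardI : (1 < #|I|)%N.
  rewrite ltnNge; apply/negP => I1.
  have : #|I|%:R <= 1 :> R by rewrite (ler_nat R _ 1).
  have := powR_ge0 c t; nra.
elim: {S}_.+1 {-2}S (ltnSn #|S|) => // m IH S Sm U r Ur r0 EU.
have [[i iS dr]|small] := pselect (exists2 i, i \in S & d <= r i).
  rewrite (bigD1 i) //=; apply: ler_wpDr; first by apply: sumr_ge0 => *; exact: powR_ge0.
  by apply: powR_le_base => //; exact: ltW.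
have {}small i : i \in S -> r i < d.
  by move=> iS; rewrite ltNge; apply/negP => ?; apply: small; exists i.
pose meets j i := `[< exists2 x, E x & U i (g j x) >].
pose T j := [set i in S | meets j i]%SET.
have meets_inj i j j' : i \in S -> meets j i -> meets j' i -> j = j'.
  move=> iS /asboolP[x Ex Ux] /asboolP[y Ey Uy]; apply/eqP/negPn/negP => jj'.
  have := gd _ _ _ _ jj' Ex Ey; have := Ur _ _ _ Ux Uy; have := small _ iS; lra.
have Tne j : exists i, i \in T j.
  have [i iS Ui] := EU _ (gE j _ Ee).
  by exists i; rewrite inE iS; apply/asboolP; exists e.
have Tlt j : (#|T j| < m)%N.
  have [j' jj'] : exists j', j' != j.
    by have /card_gt0P[j' ] : (0 < #|predC1 j|)%N by [rewrite cardC1; lia|]; exists j'.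
  have [i iT] := Tne j'.
  apply: (@leq_trans #|S|); last by lia.
  apply: proper_card; apply/properP; split.
    by apply/fintype.subsetP => k; rewrite inE => /andP[].
  move: iT; rewrite inE => /andP[iS mi]; exists i => //; rewrite inE iS /=.
  by apply/negP => /(meets_inj _ _ _ iS mi) /eqP; rewrite (negbTE jj').
have piece j : c `^ t * d `^ t <= \sum_(i in T j) r i `^ t.
  have : d `^ t <= \sum_(i in T j) (r i / c) `^ t.
    apply: (IH (T j) (Tlt j) (fun i => [set x | E x /\ U i (g j x)])).
    - move=> i x y [Ex Ux] [Ey Uy]; rewrite ler_pdivlMr// mulrC.
    by apply: le_trans (gc j _ _ Ex Ey) _; exact: Ur.
    - by move=> i; apply: divr_ge0 => //; exact: ltW.
    - move=> x Ex; have [i iS Ui] := EU _ (gE j _ Ex); exists i => //.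
    by rewrite inE iS; apply/asboolP; exists x.
  rewrite -(ler_pM2l (powR_gt0 t c0)) mulr_sumr => /le_trans; apply.
  apply: ler_sum => i _; rewrite -powRM ?(ltW c0)// ?divr_ge0 ?(ltW c0)//.
  by rewrite mulrCA divff ?mulr1// gt_eqF.
have le1 : d `^ t <= \sum_j \sum_(i in T j) r i `^ t.
  apply: (@le_trans _ _ (\sum_(j : I) c `^ t * d `^ t)); last exact: ler_sum.
  rewrite sumr_const -mulr_natl mulrA ler_peMl //; exact: powR_ge0.
apply: (le_trans le1).
(* After the sums are exchanged, each [i] is counted for at most one [j]. *)
rewrite (eq_bigr (fun j => \sum_(i in S) if meets j i then r i `^ t else 0)); last first.
  by move=> j _; rewrite -big_mkcondr; apply: eq_bigl => i; rewrite inE.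
rewrite exchange_big /=; apply: ler_sum => i iS.
have [[j mj]|no] := pselect (exists j, meets j i).
  rewrite (bigD1 j) //= mj big1 ?addr0// => j' jj'.
  by case: ifP => // /(meets_inj _ _ _ iS mj) /eqP; rewrite eq_sym (negbTE jj').
by rewrite big1 ?powR_ge0// => j _; case: ifP => // mj; case: no; exists j.
Qed.
Lemma diam_ge0 (R : realType) (A : set R) : (0 <= diam A)%E.
Proof. by apply: ereal_sup_ubound; left. Qed.

Lemma dist_le_diam (R : realType) (A : set R) (x y : R) :
  A x -> A y -> ((`|x - y|)%:E <= diam A)%E.
Proof. by move=> Ax Ay; apply: ereal_sup_ubound; right; exists x => //; exists y. Qed.

Lemma diam_le (R : realType) (A : set R) (r : R) : 0 <= r ->
  (forall x y, A x -> A y -> `|x - y| <= r) -> (diam A <= r%:E)%E.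
Proof.
move=> r0 Ar; apply: ge_ereal_sup => _ [->|[x Ax [y Ay <-]]].
  by rewrite lee_fin.
by rewrite lee_fin; exact: Ar.
Qed.

(* The sets of a countable cover are inflated to open sets so that the total
   of the t-th powers of the diameters grows by at most d ^ t / 2. *)
Lemma hausdorff_measure_neq0 (R : realType) (I : finType) (E : set R)
    (g : I -> R -> R) (c d t : R) :
    compact E -> E !=set0 -> (forall i x, E x -> E (g i x)) ->
    0 < c < 1 -> 0 < t ->
    (forall i x y, E x -> E y -> c * `|x - y| <= `|g i x - g i y|) ->
    (forall i j x y, i != j -> E x -> E y -> d <= `|g i x - g j y|) ->
    0 < d -> 1 <= #|I|%:R * c `^ t ->
  hausdorff_measure t E != 0%E.
Proof.
move=> cE E0 gE c01 t0 gc gd d0 Ict.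
have dt0 : 0 < d `^ t by exact: powR_gt0.
suff H : ((d `^ t / 2)%:E <= hausdorff_measure t E)%E.
  by rewrite gt_eqF// (lt_le_trans _ H)// lte_fin divr_gt0.
(* The content at any one scale bounds the measure from below; at scale 1 every [diam (U i)] is
   finite. *)
apply: (@le_trans _ _ (hausdorff_content t 1 E)); last first.
  by apply: ereal_sup_ubound; exists 1 => //=; exact: ltr01.
apply: le_ereal_inf_tmp => _ [U [EU Ud] <-].
pose r0 i := fine (diam (U i)).
have r0E i : diam (U i) = (r0 i)%:E.
  rewrite /r0 fineK// ge0_fin_numE ?diam_ge0//.
  by apply: le_lt_trans (Ud i) _; exact: ltry.
have r0_ge0 i : 0 <= r0 i by rewrite fine_ge0// diam_ge0.
have Ur0 i x y : U i x -> U i y -> `|x - y| <= r0 i.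
  by move=> Ux Uy; rewrite -lee_fin -r0E; exact: dist_le_diam.
pose h i := d `^ t / 2 / 2 ^+ i.+1.
have h0 i : 0 < h i by rewrite !divr_gt0// exprn_gt0.
pose r i := (r0 i `^ t + h i) `^ t^-1.
have rt i : r i `^ t = r0 i `^ t + h i.
  rewrite -powRrM mulVf ?gt_eqF// powRr1// addr_ge0 ?powR_ge0//.
  exact: ltW.
have r0r i : r0 i < r i.
  rewrite ltNge; apply/negP => rr0.
  have := powR_le_base (ltW t0) (powR_ge0 _ _) rr0; rewrite -/(r i) rt.
  by have := h0 i; lra.
pose V i := \bigcup_(x in U i) ball x ((r i - r0 i) / 2).
have Vopen i : open (V i) by apply: bigcup_open => x _; exact: ball_open.
have UV i x : U i x -> V i x.
  move=> Ux; exists x => //; apply: ballxx.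
  by rewrite divr_gt0// subr_gt0.
have Vr i x y : V i x -> V i y -> `|x - y| <= r i.
  move=> [a Ua xa] [b Ub yb].
  have := Ur0 _ _ _ Ua Ub.
  move: xa yb; rewrite /ball/= => xa yb ab.
  have -> : x - y = (a - b) - (a - x) + (b - y) by ring.
  apply: (le_trans (ler_normD _ _)); apply: (le_trans (lerD (ler_normB _ _) (lexx _))).
  lra.
move: (cE); rewrite compact_cover => /(_ nat setT V)[].
- by move=> i _; exact: Vopen.
- by move=> x /EU[i _ Ux]; exists i => //; exact: UV.
move=> D _ DE.
have [n Dn] : exists n, forall i, i \in D -> (i < n)%N.
  exists (\max_(i <- D) i).+1 => i iD; rewrite ltnS.
  exact: leq_bigmax_seq.
have fin : d `^ t <= \sum_(i < n) r i `^ t.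
  rewrite (eq_bigl (mem [set: 'I_n]%SET)); last by move=> i; rewrite !inE.
  apply: (finite_cover_lower_bound E0 gE c01 t0 gc gd d0 Ict
    (U := fun i : 'I_n => V i) (r := fun i : 'I_n => r i)).
  - by move=> i x y; exact: Vr.
  - by move=> i; exact: powR_ge0.
  - move=> x /DE[i iD Vx]; have iN := Dn _ iD.
    by exists (Ordinal iN); rewrite ?inE.
have sumh : \sum_(i < n) h i <= d `^ t / 2.
  have -> : \sum_(i < n) h i = d `^ t / 2 * (1 - 1 / 2 ^+ n).
    elim: (n) => [|m IH]; first by rewrite big_ord0 expr0 divr1 subrr mulr0.
    rewrite big_ord_recr/= IH /h exprS; have : 2 ^+ m != 0 :> R by rewrite expf_neq0.
    by move=> ?; field.
  have : 0 <= 1 / 2 ^+ n :> R by rewrite divr_ge0// exprn_ge0.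
  by have := dt0; nra.
apply: (@le_trans _ _ (\sum_(0 <= i < n) poweR (diam (U i)) t)%E); last first.
  by apply: nneseries_lim_ge => i _ _; rewrite r0E poweR_EFin lee_fin powR_ge0.
rewrite big_mkord (eq_bigr (fun i : 'I_n => (r0 i `^ t)%:E)); last first.
  by move=> i _; rewrite r0E poweR_EFin.
rewrite sumEFin lee_fin.
move: fin; rewrite (eq_bigr (fun i : 'I_n => r0 i `^ t + h i)); last by move=> i _; exact: rt.
rewrite big_split/=; lra.
Qed.

(** Since c < 1, lowering the exponent from [t] to [s] increases c^s, so the measure is nonzero for
    every positive s < t. *)
Lemma hausdorff_dim_ge (R : realType) (I : finType) (E : set R)
    (g : I -> R -> R) (c d t : R) :
    compact E -> E !=set0 -> (forall i x, E x -> E (g i x)) ->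
    0 < c < 1 ->
    (forall i x y, E x -> E y -> c * `|x - y| <= `|g i x - g i y|) ->
    (forall i j x y, i != j -> E x -> E y -> d <= `|g i x - g j y|) ->
    0 < d -> 1 <= #|I|%:R * c `^ t ->
  (t%:E <= hausdorff_dim E)%E.
Proof.
move=> cE E0 gE c01 gc gd d0 Ict.
apply: le_ereal_inf_tmp => _ [s [s0 Hs] <-]; rewrite lee_fin leNgt; apply/negP => st.
move: Hs; apply/eqP; apply: (hausdorff_measure_neq0 cE E0 gE c01 s0 gc gd d0).
apply: (le_trans Ict); rewrite ler_wpM2l//.
by apply: ger_powR; [case/andP: c01 => -> /ltW ->|exact: ltW].
Qed.

(** * Upper bounds for the dimension *)

Lemma expr_le_eventually (R : realType) (q e : R) : 0 <= q < 1 -> 0 < e ->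
  exists N, forall n, (N <= n)%N -> q ^+ n <= e.
Proof.
move=> /andP[q0 q1] e0.
have : (fun n => q ^+ n) @ \oo --> (0 : R).
  by apply: cvg_expr; rewrite ger0_norm.
move=> /cvgr0_norm_le/(_ _ e0)[N _ HN]; exists N => n Nn.
by have := HN n Nn; rewrite /= ger0_norm// exprn_ge0.
Qed.

Lemma foldr_stable (T I : Type) (f : I -> T -> T) (C : set T) :
  (forall i x, C x -> C (f i x)) -> forall s x, C x -> C (foldr f x s).
Proof. by move=> fC; elim=> //= i s IH x Cx; apply/fC/IH. Qed.

Lemma dist_foldr_le (R : realType) (I : Type) (f : I -> R -> R) (c : R) :
    0 <= c -> (forall i x y, `|f i x - f i y| <= c * `|x - y|) ->
  forall s x y, `|foldr f x s - foldr f y s| <= c ^+ size s * `|x - y|.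
Proof.
move=> c0 fc; elim=> [|i s IH] x y /=; first by rewrite expr0 mul1r.
by apply: (le_trans (fc _ _ _)); rewrite exprS -mulrA ler_wpM2l.
Qed.

Lemma foldr_tuple_cover (T : Type) (I : finType) (f : I -> T -> T) (E : set T) :
    (forall x, E x -> exists i, exists2 y, E y & x = f i y) ->
  forall n x, E x ->
    exists w : n.-tuple I, exists2 y, E y & x = foldr f y w.
Proof.
move=> Ef; elim=> [|n IH] x Ex; first by exists [tuple]; exists x.
have [i [y Ey ->]] := Ef _ Ex.
have [w [z Ez ->]] := IH _ Ey.
by exists [tuple of i :: w]; exists z.
Qed.

(** The images of [E] under words of length n give a cover by #|I|^n sets of diameter at most c^n D,
    and the total (#|I| c^s)^n D^s tends to 0. *)
Lemma hausdorff_measure_eq0 (R : realType) (I : finType) (f : I -> R -> R)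
    (E : set R) (c D s : R) :
    0 < c < 1 -> (forall i x y, `|f i x - f i y| <= c * `|x - y|) ->
    (forall x, E x -> exists i, exists2 y, E y & x = f i y) ->
    (forall x y, E x -> E y -> `|x - y| <= D) ->
    0 < s -> #|I|%:R * c `^ s < 1 ->
  hausdorff_measure s E = 0%E.
Proof.
move=> /andP[c0 c1] fc Ef ED s0 Ics.
wlog D0 : D ED / 0 < D.
  move=> /(_ (Num.max D 1)); apply; last by rewrite lt_max ltr01 orbT.
  by move=> x y Ex Ey; rewrite le_max ED.
have content0 e : 0 < e -> hausdorff_content s e E = 0%E.
  move=> e0; apply/eqP; rewrite eq_le; apply/andP; split; last first.
    apply: le_ereal_inf_tmp => _ [U _ <-]; apply: nneseries_ge0 => i _ _.
    exact: poweR_ge0.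
  apply/lee_addgt0Pr => eps eps0; rewrite add0e.
  have [N1 HN1] := expr_le_eventually (q := c) (e := e / D) ltac:(lra) (divr_gt0 e0 D0).
  have Ds0 : 0 < D `^ s by exact: powR_gt0.
  have q01 : 0 <= #|I|%:R * c `^ s < 1 by rewrite Ics andbT mulr_ge0// powR_ge0.
  have [N2 HN2] := expr_le_eventually q01 (divr_gt0 eps0 Ds0).
  pose n := maxn N1 N2; pose d := c ^+ n * D.
  have d0 : 0 <= d by rewrite mulr_ge0 ?exprn_ge0 ?ltW.
  have de : d <= e by rewrite -ler_pdivlMr// HN1// leq_maxl.
  (* Cylinders are numbered by [enum_rank]; from index [N] on the sets are empty and contribute
     0. *)
  pose U i := [set x | exists w : n.-tuple I,
    enum_rank w = i :> nat /\ exists2 y, E y & x = foldr f y w].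
  pose N := #|{: n.-tuple I}|.
  have Ud i : (diam (U i) <= d%:E)%E.
    apply: diam_le => // _ _ [w [wi [x Ex ->]]] [w' [w'i [y Ey ->]]].
    have /enum_rank_inj -> : enum_rank w = enum_rank w'.
      by apply: val_inj; rewrite /= wi w'i.
    apply: (le_trans (dist_foldr_le (ltW c0) fc _ _ _)).
    by rewrite size_tuple ler_wpM2l ?exprn_ge0 ?(ltW c0)// ED.
  have Ubig i : (N <= i)%N -> diam (U i) = 0%E.
    move=> Ni; apply/eqP; rewrite eq_le diam_ge0 andbT.
    apply: diam_le => // x y [w [wi _]].
    by have := ltn_ord (enum_rank w); rewrite wi ltnNge Ni.
  apply: (@le_trans _ _ (\sum_(0 <= i <oo) poweR (diam (U i)) s)%E).
    apply: ereal_inf_lbound; exists U => //; split; last first.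
      by move=> i; apply: (le_trans (Ud i)); rewrite lee_fin.
    move=> x /(foldr_tuple_cover Ef n)[w [y Ey xy]].
    by exists (enum_rank w : nat) => //; exists w; split=> //; exists y.
  apply: lime_le.
    by apply: is_cvg_nneseries => i _ _; exact: poweR_ge0.
  exists N => // m /= Nm; rewrite (@big_cat_nat _ _ _ N)//=.
  rewrite [X in (_ + X)%E]big_nat_cond [X in (_ + X)%E]big1 ?adde0; last first.
    move=> i /andP[/andP[Ni _] _]; rewrite Ubig// poweR_EFin powR0//.
    by rewrite gt_eqF.
  apply: (@le_trans _ _ (\sum_(0 <= i < N) (d `^ s)%:E)%E).
    apply: lee_sum => i _; have := Ud i; have := diam_ge0 (U i).
    case: (diam (U i)) => //= r; rewrite !lee_fin => r0 rd.
    exact: powR_le_base (ltW s0) _ _.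
  rewrite sumEFin lee_fin big_mkord sumr_const card_ord -mulr_natl /N.
  have -> : d `^ s = (c `^ s) ^+ n * D `^ s.
    rewrite powRM ?exprn_ge0 ?(ltW c0) ?(ltW D0)//; congr (_ * _).
    rewrite -(powR_mulrn _ (powR_ge0 c s)) -(powR_mulrn _ (ltW c0)).
    by rewrite -!powRrM mulrC.
  rewrite card_tuple natrX mulrA -exprMn -ler_pdivlMr//.
  by rewrite HN2// leq_maxr.
apply/eqP; rewrite eq_le; apply/andP; split.
  by apply: ge_ereal_sup => _ [e e0 <-]; rewrite content0.
by apply: ereal_sup_ubound; exists 1 => /=; [exact: ltr01|exact: content0].
Qed.

Lemma hausdorff_dim_ge0 (R : realType) (E : set R) : (0 <= hausdorff_dim E)%E.
Proof. by apply: le_ereal_inf_tmp => _ [s [s0 _] <-]; rewrite lee_fin ltW. Qed.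

Lemma hausdorff_dim_le (R : realType) (I : finType) (f : I -> R -> R)
    (E : set R) (c D s : R) :
    0 < c < 1 -> (forall i x y, `|f i x - f i y| <= c * `|x - y|) ->
    (forall x, E x -> exists i, exists2 y, E y & x = f i y) ->
    (forall x y, E x -> E y -> `|x - y| <= D) ->
    0 < s -> #|I|%:R * c `^ s < 1 ->
  (hausdorff_dim E <= s%:E)%E.
Proof.
move=> c01 fc Ef ED s0 Ics; apply: ereal_inf_lbound; exists s => //.
by split=> //; exact: hausdorff_measure_eq0 c01 fc Ef ED s0 Ics.
Qed.

(** * Cylinders and the packing bound *)

Lemma cylinder_of_size (R : realType) (I : Type) (f : I -> R -> R) (k : I -> R)
    (C : set R) (Q e : R) :
    0 < Q -> (forall i, Q^-1 <= k i <= 2^-1) ->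
    (forall i x y, `|f i x - f i y| = k i * `|x - y|) ->
    (forall x, C x -> exists i, exists2 y, C y & x = f i y) ->
    0 < e <= 1 ->
  forall x, C x -> exists (s : seq I) (a : R),
    [/\ exists2 y, C y & x = foldr f y s, e / Q <= a <= e &
      forall y z, `|foldr f y s - foldr f z s| = a * `|y - z|].
Proof.
move=> Q0 kQ fk Cf /andP[e0 e1].
(* The word follows a coding of [x] until its ratio is at most [e]. Each letter contributes a factor
   between 1/Q and 1/2, so the ratio does not fall below e / Q and [n] bounds the number of
   letters. *)
have [n ne] : exists n, 2^-1 ^+ n <= e.
  have [N HN] := expr_le_eventually (q := 2^-1) ltac:(lra) e0.
  by exists N; exact: HN.
elim: n e e0 e1 ne => [|n IH] e e0 e1 ne x Cx.
  have -> : e = 1 by apply/eqP; rewrite eq_le e1.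
  have [i _] := Cf _ Cx; have /andP[Qk k2] := kQ i.
  exists [::], 1; split; first by exists x.
  - by rewrite lexx andbT mul1r; lra.
  - by move=> y z; rewrite mul1r.
have [i [x' Cx' xx']] := Cf _ Cx.
have /andP[Qk k2] := kQ i.
have k0 : 0 < k i by apply: lt_le_trans Qk; rewrite invr_gt0.
have [ke|ek] := leP (k i) e.
  exists [:: i], (k i); split; first by exists x'.
  - rewrite ke andbT; apply: le_trans Qk; rewrite ler_piMl// invr_ge0; exact: ltW.
  - by move=> y z /=; exact: fk.
have [|||s [a [[y Cy x'y] /andP[ae1 ae2] sa]]] := IH (e / k i) _ _ _ _ Cx'.
- exact: divr_gt0.
- by rewrite ler_pdivrMr// mul1r ltW.
- rewrite ler_pdivlMr//; apply: le_trans ne; rewrite exprSr.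
  by rewrite ler_wpM2l// exprn_ge0.
exists (i :: s), (k i * a); split.
- by exists y => //=; rewrite -x'y.
- have -> : e / Q = k i * (e / k i / Q) by field; rewrite !gt_eqF.
  by rewrite ler_wpM2l ?(ltW k0)//= mulrC -ler_pdivlMr.
- by move=> y' z /=; rewrite fk sa mulrA.
Qed.

(* If the points [h a] are more numerous than [(D * Q / e) `^ Delta], the
   cylinders of size about [e] around them generate, by themselves, a
   self-similar subset of dimension larger than [Delta]. *)
Lemma separated_card_le (R : realType) (I A : finType) (f : I -> R -> R)
    (k : I -> R) (C : set R) (Q D e Delta : R) (h : A -> R) :
    compact C -> (forall i x, C x -> C (f i x)) ->
    (forall x, C x -> exists i, exists2 y, C y & x = f i y) ->
    2 <= Q -> (forall i, Q^-1 <= k i <= 2^-1) ->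
    (forall i x y, `|f i x - f i y| = k i * `|x - y|) ->
    1 <= D -> (forall x y, C x -> C y -> `|x - y| <= D) ->
    hausdorff_dim C = Delta%:E ->
    0 < e <= 1 -> (forall a, C (h a)) ->
    (forall a b, a != b -> 3 * e <= `|h a - h b|) ->
  #|A|%:R <= (D * Q / e) `^ Delta.
Proof.
move=> cC fC Cf Q2 kQ fk D1 CD dimC /andP[e0 e1] Ch he.
have Delta0 : 0 <= Delta by rewrite -lee_fin -dimC hausdorff_dim_ge0.
pose K := D * Q / e.
have K2 : 2 <= K.
  by rewrite /K ler_pdivlMr//; nra.
have [A1|A1] := leP (#|A|%:R : R) 1.
  apply: (le_trans A1); rewrite -(powRr0 K); apply: ler_powR => //; lra.
have D0 : 0 < D by lra.
have Q0 : 0 < Q by lra.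
have eD : 0 < e / D <= 1.
  by rewrite divr_gt0//= ler_pdivrMr// mul1r; lra.
(* [t] solves K^t = #|A|, so the claim becomes t <= Delta; [#|A|] separated maps with ratios at
   least 1/K force dimension at least [t]. *)
pose t := ln #|A|%:R / ln K.
have lnK0 : 0 < ln K by rewrite ln_gt0; lra.
have Kt : K `^ t = #|A|%:R.
  rewrite /powR gt_eqF; last lra.
  by rewrite /t divfK ?gt_eqF// lnK ?posrE; lra.
rewrite -Kt; apply: ler_powR; first lra.
have cyl a : exists (g : R -> R) (l : R), [/\ exists2 y, C y & h a = g y,
    K^-1 <= l <= e / D, forall x, C x -> C (g x) &
    forall y z, `|g y - g z| = l * `|y - z|].
  have [s [l [hy /andP[l1 l2] sl]]] := cylinder_of_size Q0 kQ fk Cf eD (Ch a).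
  exists (fun x => foldr f x s), l; split => //.
  - rewrite l2 andbT; move: l1; congr (_ <= _).
    by rewrite /K; field; rewrite !gt_eqF.
  - by move=> x; apply: foldr_stable.
have [g /choice[l gl]] := choice cyl.
have A0 : (0 < #|A|)%N by rewrite lt0n; apply/eqP => A0; move: A1; rewrite A0 ltr10.
rewrite -lee_fin -dimC.
apply: (@hausdorff_dim_ge _ A C g K^-1 e) => //.
- by have /card_gt0P[a _] := A0; exists (h a).
- by move=> a; case: (gl a).
- by rewrite invr_gt0 invf_lt1; lra.
- move=> a x y Cx Cy; case: (gl a) => _ /andP[la _] _ ->.
  by rewrite ler_wpM2r.
- move=> a b x y ab Cx Cy.
  (* A ratio of at most e / D keeps the image of [C] under [g a] within [e] of [h a], so separation
     3e leaves a gap of [e] between the images. *)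
  have near_h a' x' : C x' -> `|h a' - g a' x'| <= e.
    move=> Cx'; case: (gl a') => -[y' Cy' ->] /andP[_ le] _ ->.
    have := CD _ _ Cy' Cx'; have := normr_ge0 (y' - x').
    move: le; rewrite ler_pdivlMr//; nra.
  have := he _ _ ab; have := near_h a x Cx; have := near_h b y Cy.
  have -> : h a - h b = (h a - g a x) + (g a x - g b y) - (h b - g b y) by ring.
  have := ler_normB (h a - g a x + (g a x - g b y)) (h b - g b y).
  have := ler_normD (h a - g a x) (g a x - g b y); lra.
- have -> : K^-1 `^ t = (K `^ t)^-1.
    by rewrite -powR_inv1 -?powRrM ?mulN1r ?powRN; lra.
  by rewrite Kt divff// gt_eqF//; lra.
Qed.

(** Iterating [g] from a point of [C] stays in [C] and converges to the fixed point. *)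
Lemma fixed_point_mem (R : realType) (C : set R) (g : R -> R) (c x : R) :
    closed C -> C !=set0 -> (forall y, C y -> C (g y)) ->
    0 <= c < 1 -> (forall y z, `|g y - g z| <= c * `|y - z|) ->
  g x = x -> C x.
Proof.
move=> clC [a Ca] gC c01 gc gx; apply: clC => B /nbhs_ballP[e /= e0 eB].
have d0 : 0 < 2 * (`|x - a| + 1) by rewrite mulr_gt0// ltr_wpDl.
have [N /(_ _ (leqnn N))] := expr_le_eventually c01 (divr_gt0 e0 d0).
rewrite ler_pdivlMr// => HN.
exists (iter N g a); split; first by elim: {HN} N => //= n IH; exact: gC.
apply: eB; rewrite /ball/=.
have c0 : 0 <= c by case/andP: c01.
have : `|x - iter N g a| <= c ^+ N * `|x - a|.
  elim: {HN} N => [|n IH] /=; first by rewrite expr0 mul1r.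
  rewrite -{1}gx; apply: (le_trans (gc _ _)); rewrite exprS -mulrA.
  by rewrite ler_wpM2l.
have := exprn_ge0 N c0; have := normr_ge0 (x - a); nra.
Qed.

(** Dependent choice: a preimage function, given a default value outside [C], is iterated from
    [x]. *)
Lemma coding (T I : Type) (f : I -> T -> T) (C : set T) :
    (forall x, C x -> exists i, exists2 y, C y & x = f i y) ->
  forall x, C x -> exists (j : nat -> I) (y : nat -> T),
    [/\ y 0 = x, forall n, C (y n) & forall n, y n = f (j n) (y n.+1)].
Proof.
move=> Cf x Cx; have [i0 _] := Cf _ Cx.
have step z : exists w : I * T, C z -> C w.2 /\ z = f w.1 w.2.
  have [Cz|nCz] := pselect (C z); last by exists (i0, z).
  by have [i [y Cy zy]] := Cf _ Cz; exists (i, y).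
have [g Hg] := choice step.
pose y n := iter n (fun z => (g z).2) x.
have Cy n : C (y n) by elim: n => //= n IH; exact: (Hg _ IH).1.
by exists (fun n => (g (y n)).1), y; split => // n; have [] := Hg _ (Cy n).
Qed.

Lemma attractor_stable (R : realType) (J : nat) (f : 'I_J -> R -> R) (C : set R) :
  is_attractor f C -> forall i x, C x -> C (f i x).
Proof. by case=> _ _ fC i x Cx; rewrite -fC; exists i => //; exists x. Qed.

Lemma attractor_cover (R : realType) (J : nat) (f : 'I_J -> R -> R) (C : set R) :
  is_attractor f C -> forall x, C x -> exists i, exists2 y, C y & x = f i y.
Proof.
by case=> _ _ {1}<- x [i _ [y Cy <-]]; exists i, y.
Qed.

Lemma compact_dist_bounded (R : realType) (C : set R) : compact C ->
  exists2 D, 1 <= D & forall x y, C x -> C y -> `|x - y| <= D.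
Proof.
move=> /compact_bounded[M [_ HM]].
have {}HM x : C x -> `|x| <= `|M| + 1.
  by apply: HM; have := ler_norm M; lra.
exists (2 * (`|M| + 1)) => [|x y Cx Cy]; first by have := normr_ge0 M; lra.
by have := ler_normB x y; have := HM _ Cx; have := HM _ Cy; lra.
Qed.

(** * Rational points near an attractor *)

Section IfsMap.
Context (R : realType) (J : nat) (p r : 'I_J -> int) (q : 'I_J -> nat).
Hypothesis p_unit : forall j, p j = 1 \/ p j = -1.
Hypothesis q_ge2 : forall j, (2 <= q j)%N.
Local Notation F := (ifs_map (R := R) p r q).

Lemma ifs_map_dist j x y : `|F j x - F j y| = (q j)%:R^-1 * `|x - y|.
Proof.
have -> : F j x - F j y = (p j)%:~R * (q j)%:R^-1 * (x - y).
  by rewrite /ifs_map; ring.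
rewrite !normrM (@ger0_norm _ (_^-1)) ?invr_ge0//; congr (_ * _).
by case: (p_unit j) => ->; rewrite ?mulrN1z ?normrN normr1 mul1r.
Qed.

Lemma ifs_map_ratio_le j x y : `|F j x - F j y| <= 2^-1 * `|x - y|.
Proof.
rewrite ifs_map_dist ler_wpM2r// lef_pV2 ?posrE ?ltr0n ?ler_nat//.
by have := q_ge2 j; lia.
Qed.

(** The dimension is finite, so [fine] loses nothing: ratios at most 1/2 and J < 2^(J+1) bound it by
    J + 1. *)
Lemma ifs_attractor_dim (C : set R) :
  is_attractor F C -> hausdorff_dim C = (fine (hausdorff_dim C))%:E.
Proof.
move=> CF; case: (CF) => _ cC _; have [D _ CD] := compact_dist_bounded cC.
rewrite fineK// ge0_fin_numE ?hausdorff_dim_ge0//.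
apply: le_lt_trans (ltry (J.+1)%:R).
have half01 : 0 < (2^-1 : R) < 1 by lra.
apply: (hausdorff_dim_le half01 ifs_map_ratio_le (attractor_cover CF) CD).
  by rewrite ltr0n.
rewrite card_ord powR_mulrn; last lra.
by rewrite exprVn ltr_pdivrMr ?exprn_gt0// mul1r -natrX ltr_nat (ltn_trans (ltnSn J))// ltn_expl.
Qed.

(* Expanding along the coding of [c] keeps the denominator [v]; a repetition
   along the orbit of [u / v] would be a fixed point of a composition of the
   maps, hence a point of [C]. *)
Lemma ifs_orbit (C : set R) (Q : R) (u : int) (v : nat) (c : R) :
    is_attractor F C -> (forall j, (q j)%:R <= Q) -> (0 < v)%N ->
    ~ C (u%:~R / v%:R) -> C c ->
  exists (j : nat -> 'I_J) (U : nat -> int) (y : nat -> R),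
    [/\ injective U, forall n, C (y n), forall n, y n = F (j n) (y n.+1) &
      forall n, `|(U n)%:~R / v%:R - y n| <= Q ^+ n * `|u%:~R / v%:R - c|].
Proof.
move=> CF qQ v0 nCx Cc.
have stab := attractor_stable CF.
have [j [y [y0 Cy yS]]] := coding (attractor_cover CF) Cc.
(* As p^2 = 1, the inverse of y -> (p y + r) / q is x -> p (q x - r); [U] iterates it on numerators
   over [v]. *)
pose U := fix U n : int :=
  if n is m.+1 then p (j m) * ((q (j m))%:Z * U m - r (j m) * v%:Z) else u.
pose X n : R := (U n)%:~R / v%:R.
have vn0 : v%:R != 0 :> R by rewrite pnatr_eq0 -lt0n.
have XS n : X n = F (j n) (X n.+1).
  rewrite /X /= /ifs_map !rmorphM/= rmorphB/= !rmorphM/= !pmulrn.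
  have qn0 : (q (j n))%:R != 0 :> R.
    by rewrite pnatr_eq0; have := q_ge2 (j n); lia.
  have : (p (j n))%:~R * (p (j n))%:~R = 1 :> R.
    by case: (p_unit (j n)) => ->; rewrite ?mulrN1z ?mulrNN mulr1.
  rewrite !pmulrn in qn0 vn0 *.
  move: ((p (j n))%:~R : R) => P PP.
  move: ((q (j n))%:~R : R) ((U n)%:~R : R) ((r (j n))%:~R : R) qn0 => k Un rn k0.
  have -> : P / k * (P * (k * Un - rn * v%:~R) / v%:~R) =
      P * P / k * ((k * Un - rn * v%:~R) / v%:~R) by ring.
  by rewrite PP; field; rewrite k0 vn0.
exists j, U, y; split => // [|n]; last first.
  elim: n => [|n IH]; first by rewrite expr0 mul1r y0.
  have : `|X n - y n| = (q (j n))%:R^-1 * `|X n.+1 - y n.+1|.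
    by rewrite XS yS ifs_map_dist.
  rewrite -[_ - y n.+1]/(X n.+1 - y n.+1) => H.
  have q0 : 0 < (q (j n))%:R :> R by rewrite ltr0n; have := q_ge2 (j n); lia.
  have -> : `|X n.+1 - y n.+1| = (q (j n))%:R * `|X n - y n|.
    by rewrite H mulrA divff ?mul1r// gt_eqF.
  rewrite exprS -mulrA; apply: ler_pM => //; exact: ltW.
have word m n : X m = foldr F (X (m + n)%N) (map j (iota m n)).
  elim: n m => [|n IH] m /=; first by rewrite addn0.
  by rewrite XS IH addSnnS.
suff noloop m n : (m < n)%N -> U m <> U n.
  move=> m n Umn; apply/eqP; case: ltngtP => // /noloop; [exact|].
  by move=> /(_ (esym Umn)).
(* [X 0] is an image of [X m] under maps preserving [C], so it suffices that [X m] lies in [C]; it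
   does, being fixed by the nonempty word read from [m] to [n]. *)
move=> mn Umn; apply: nCx; rewrite -[u]/(U 0%N) -/(X 0%N).
rewrite (word 0%N m) add0n; apply: foldr_stable => //.
have Xmn : X m = X n by rewrite /X Umn.
have half0 : 0 <= (2^-1 : R) by lra.
have contr := dist_foldr_le half0 ifs_map_ratio_le (map j (iota m (n - m))).
have clC : closed C by case: CF => _ cC _; apply: compact_closed => //; exact: norm_hausdorff.
apply: (fixed_point_mem clC _ _ _ contr) => /=.
- by exists c.
- by move=> z; apply: foldr_stable.
- rewrite exprn_ge0//= exprn_ilt1//; [|lra].
  by rewrite size_map size_iota subn_eq0 -ltnNge.
- by have := word m (n - m)%N; rewrite (subnKC (ltnW mn)) -Xmn => {2}->.
Qed.

End IfsMap.

Lemma set_dist_attained (R : realType) (C : set R) (x : R) :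
  compact C -> C !=set0 -> exists2 c, C c & set_dist C [set x] = `|c - x|.
Proof.
move=> cC C0.
have cont : {within C, continuous (fun c : R => `|c - x|)}.
  apply: continuous_subspaceT => c; apply: cvg_norm; apply: cvgB; first exact: cvg_id.
  exact: cvg_cst.
have [c /set_mem Cc cmin] := compact_EVT_min C0 cC cont.
exists c => //; apply/eqP; rewrite eq_le; apply/andP; split.
  apply: ge_inf; last by exists c => //; exists x.
  by exists 0 => _ [a _ [b _ <-]].
apply: lb_le_inf; first by exists `|c - x|, c => //; exists x.
by move=> _ [a Ca [b -> <-]]; apply: cmin; exact: mem_set.
Qed.

Lemma dist_ratio_ge (R : realType) (m n : int) (v : nat) : (0 < v)%N -> m != n ->
  v%:R^-1 <= `|m%:~R / v%:R - n%:~R / v%:R : R|.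
Proof.
move=> v0 mn; rewrite -mulrBl normrM [X in _ * X]ger0_norm ?invr_ge0//.
rewrite ler_peMl ?invr_ge0// -rmorphB/= -intr_norm (ler_int R 1).
by move: mn; lia.
Qed.

(* If the attractor is a single point, any two of the maps commute. *)
Lemma osc_attractor_two_points (R : realType) (J : nat) (p r : 'I_J -> int)
    (q : 'I_J -> nat) (C : set R) :
    (2 <= J)%N -> is_attractor (ifs_map (R := R) p r q) C ->
    open_set_condition (ifs_map (R := R) p r q) ->
  exists x y, [/\ C x, C y & x != y].
Proof.
move=> J2 CF [V [[s Vs] _ _ fV disj]].
have [[c Cc] _ _] := CF.
apply: contrapT => not_two.
have Cfix i : ifs_map p r q i c = c.
  apply/eqP/negPn/negP => ne; apply: not_two; exists (ifs_map p r q i c), c; split => //.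
  exact: attractor_stable CF _ _ Cc.
have J0 : (0 < J)%N by exact: ltn_trans J2.
pose i := Ordinal J0; pose j := Ordinal J2.
have commute : ifs_map p r q i (ifs_map p r q j s) = ifs_map p r q j (ifs_map p r q i s).
  have := Cfix j; have := Cfix i; rewrite /ifs_map.
  set a := (p i)%:~R / (q i)%:R; set b := (p j)%:~R / (q j)%:R.
  set a' := (r i)%:~R / (q i)%:R; set b' := (r j)%:~R / (q j)%:R.
  move=> fixi fixj.
  have -> : a' = c - a * c by rewrite -{1}fixi; ring.
  have -> : b' = c - b * c by rewrite -{1}fixj; ring.
  by ring.
have : (ifs_map p r q i @` V `&` ifs_map p r q j @` V) (ifs_map p r q i (ifs_map p r q j s)).
  split; first by exists (ifs_map p r q j s) => //; apply: fV; exists s.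
  by rewrite commute; exists (ifs_map p r q i s) => //; apply: fV; exists s.
by rewrite disj.
Qed.

Lemma ifs_separated_card (R : realType) (J : nat) (p r : 'I_J -> int)
    (q : 'I_J -> nat) (C : set R) :
    (forall j, p j = 1 \/ p j = -1) -> (forall j, (2 <= q j)%N) ->
    is_attractor (ifs_map (R := R) p r q) C ->
  exists Q D : R, [/\ 2 <= Q, 1 <= D, forall j, (q j)%:R <= Q &
    forall (A : finType) (h : A -> R) (e : R), 0 < e <= 1 ->
      (forall a, C (h a)) -> (forall a b, a != b -> 3 * e <= `|h a - h b|) ->
      #|A|%:R <= (D * Q / e) `^ fine (hausdorff_dim C)].
Proof.
move=> p_unit q_ge2 CF; have [_ cC _] := CF.
have [D D1 CD] := compact_dist_bounded cC.
pose Q : R := (\sum_j q j).+2%:R.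
have qQ j : (q j)%:R <= Q.
  by rewrite ler_nat (bigD1 j)//=; lia.
have Q2 : 2 <= Q by rewrite ler_nat.
exists Q, D; split => // A h e e01 Ch he.
apply: (@separated_card_le R _ A _ (fun j => (q j)%:R^-1) C Q D e _ h) => //.
- exact: attractor_stable CF.
- exact: attractor_cover CF.
- move=> j; have q0 : 0 < (q j)%:R :> R by rewrite ltr0n; have := q_ge2 j; lia.
  by rewrite !lef_pV2 ?posrE// ?qQ ?ler_nat ?q_ge2//; lra.
- by move=> j x y; exact: ifs_map_dist.
- exact: (ifs_attractor_dim p_unit q_ge2 CF).
Qed.

Lemma ifs_rational_gap (R : realType) (J : nat) (p r : 'I_J -> int)
    (q : 'I_J -> nat) (C : set R) :
    (forall j, p j = 1 \/ p j = -1) -> (forall j, (2 <= q j)%N) ->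
    is_attractor (ifs_map (R := R) p r q) C ->
  exists Q K : R, [/\ 1 <= Q, 0 <= K & forall (u : int) (v : nat) (c : R),
    (0 < v)%N -> ~ C (u%:~R / v%:R) -> C c ->
    (8 * v%:R)^-1 <
      Q `^ (K * v%:R `^ fine (hausdorff_dim C)) * `|u%:~R / v%:R - c|].
Proof.
move=> p_unit q_ge2 CF.
have [Q [D [Q2 D1 qQ card]]] := ifs_separated_card p_unit q_ge2 CF.
set Delta := fine _ in card *.
exists Q, ((4 * D * Q) `^ Delta); split; [lra|exact: powR_ge0|].
move=> u v c v0 nCx Cc.
have [j [U [y [Uinj Cy _ Uy]]]] := ifs_orbit p_unit q_ge2 CF qQ v0 nCx Cc.
have vR : 1 <= v%:R :> R by rewrite ler1n.
set x := u%:~R / v%:R in nCx Uy *.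
rewrite -powRM; [|nra|lra].
pose z := (4 * D * Q * v%:R) `^ Delta.
(* [z] is the packing bound at e = 1/(4v); the T + 1 > z first orbit points will exceed it. *)
have [T /andP[Tz zT]] : exists T : nat, T%:R <= z < T.+1%:R.
  by exists (Num.truncn z); apply: truncn_itv; exact: powR_ge0.
apply: (@lt_le_trans _ _ (Q ^+ T * `|x - c|)); last first.
  rewrite ler_wpM2r// -powR_mulrn; last lra.
  apply: ler_powR => //; lra.
rewrite ltNge; apply/negP => small.
have near n : (n < T.+1)%N -> `|(U n)%:~R / v%:R - y n| <= (8 * v%:R)^-1.
  move=> nT; apply: (le_trans (Uy n)); apply: le_trans small.
  by rewrite ler_wpM2r// ler_weXn2l//; lra.
have : (#|'I_T.+1|%:R : R) <= (D * Q / (4 * v%:R)^-1) `^ Delta.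
  apply: (card 'I_T.+1 (fun n => y n)) => [|n|m n mn]; last 2 first.
  - exact: Cy.
  - have Umn : U m != U n by apply/eqP => /Uinj/val_inj/eqP; exact/negP.
    have := dist_ratio_ge R v0 Umn.
    have := near _ (ltn_ord m); have := near _ (ltn_ord n).
    set a := _ / _; set b := _ / v%:R => an bm.
    have -> : b - a = (b - y m) + (y m - y n) - (a - y n) by ring.
    (* With w = 1/v this is the count 1/v - 2/(8v) = 3/(4v), that is 3e. *)
    have tri : forall w e1 e2 e3 e4 e5 : R, e5 <= 8^-1 * w -> e4 <= 8^-1 * w ->
      e3 <= e4 + e2 -> e1 <= e3 + e5 -> w <= e1 -> 3 * (4^-1 * w) <= e2.
      by move=> *; lra.
    move: an bm; rewrite !invfM => an bm; apply: tri an bm _ _.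
    - exact: ler_normD.
    - exact: ler_normB.
  - by rewrite invr_gt0 invf_le1; nra.
have -> : D * Q / (4 * v%:R)^-1 = 4 * D * Q * v%:R by rewrite invrK; ring.
by rewrite card_ord -/z; lra.
Qed.

Lemma ifs_dist_lower_bound (R : realType) (J : nat) (p r : 'I_J -> int)
    (q : 'I_J -> nat) (C : set R) :
    (2 <= J)%N -> (forall j, p j = 1 \/ p j = -1) -> (forall j, (2 <= q j)%N) ->
    is_attractor (ifs_map (R := R) p r q) C ->
    open_set_condition (ifs_map (R := R) p r q) ->
    let Delta : R := fine (hausdorff_dim C) in
    exists rho0 : R, forall rho : R, rho0 <= rho ->
      forall (u : int) (v : nat), (1 <= v)%N -> ~ C (u%:~R / v%:R) ->
        expR (- (rho * v%:R `^ Delta)) < set_dist C [set u%:~R / v%:R].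
Proof.
move=> J2 p_unit q_ge2 CF osc Delta.
(* For Delta = 0 the packing bound would be 1, contradicted by two distinct points of [C].
   Positivity lets v^Delta absorb ln v below. *)
have Delta0 : 0 < Delta.
  have : 0 <= Delta by rewrite fine_ge0// hausdorff_dim_ge0.
  rewrite le_eqVlt => /orP[/eqP D0|//]; exfalso.
  have [x [y [Cx Cy xy]]] := osc_attractor_two_points J2 CF osc.
  have [Q [D [Q2 D1 qQ card]]] := ifs_separated_card p_unit q_ge2 CF.
  have d0 : 0 < `|x - y| by rewrite normr_gt0 subr_eq0.
  pose e := Num.min 1 (`|x - y| / 3).
  have e0 : 0 < e by rewrite lt_min ltr01 divr_gt0.
  have e3 : 3 * e <= `|x - y| by rewrite mulrC -ler_pdivlMr// ge_min lexx orbT.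
  have : #|{: bool}|%:R <= (D * Q / e) `^ Delta.
    apply: (card bool (fun b => if b then x else y)).
    - by rewrite e0 ge_min lexx.
    - by case.
    - by case; case => //= _; rewrite // distrC.
  by rewrite -D0 powRr0 card_bool (ler_nat R 2 1).
have [Q [K [Q1 K0 gap]]] := ifs_rational_gap p_unit q_ge2 CF.
(* Multiplied by v^Delta >= 1, the three terms dominate ln 8, ln v and the exponent of the gap; the
   middle one comes from ln z < z for z = v^Delta. *)
exists (ln 8 + Delta^-1 + K * ln Q) => rho rho_ge u v v0 nCx.
have [C0 cC _] := CF.
have [c Cc ->] := set_dist_attained (u%:~R / v%:R) cC C0.
rewrite distrC; have := gap _ _ _ v0 nCx Cc; rewrite -/Delta.
have vR : 1 <= v%:R :> R by rewrite ler1n.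
set z := v%:R `^ Delta.
have z1 : 1 <= z by rewrite -[1](powRr0 v%:R); apply: ler_powR => //; exact: ltW.
have lnv : ln v%:R < Delta^-1 * z.
  by rewrite mulrC ltr_pdivlMr// mulrC -ln_powR; apply: ln_sublinear; apply: powR_gt0; lra.
have ln8 : 0 <= ln 8 :> R by rewrite ln_ge0//; lra.
have lnQ : 0 <= ln Q by rewrite ln_ge0.
set d := `|_| => gapd.
have Qpos : 0 < Q `^ (K * z) by apply: powR_gt0; lra.
apply: lt_trans (_ : (8 * v%:R)^-1 / Q `^ (K * z) < _); last first.
  by rewrite ltr_pdivrMr// (mulrC d).
rewrite -invfM expRN ltf_pV2 ?posrE ?expR_gt0 ?mulr_gt0//; last lra.
have -> : 8 * v%:R * Q `^ (K * z) = expR (ln 8 + ln v%:R + K * z * ln Q).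
  rewrite !expRD !lnK ?posrE//; [|lra]; congr (_ * _).
  by rewrite /powR gt_eqF//; lra.
rewrite ltr_expR; apply: lt_le_trans (_ : (ln 8 + Delta^-1 + K * ln Q) * z <= _).
  have : ln 8 * 1 <= ln 8 * z by rewrite ler_wpM2l.
  lra.
by rewrite ler_wpM2r//; lra.
Qed.

(** * Missing digit sets *)

Section MissingDigits.
Context (R : realType) (b : nat) (W : {set 'I_b}).
Hypothesis b_ge3 : (3 <= b)%N.
Local Notation C := (missing_digit_set (R := R) W).
Local Notation digit j := (nat_of_ord (@enum_val _ (mem W) j)).
Local Notation F := (ifs_map (R := R) (fun _ : 'I_#|W| => 1)
  (fun j => Posz (digit j)) (fun _ => b)).

Let b_gt0 : 0 < b%:R :> R.
Proof. by rewrite ltr0n; lia. Qed.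

Lemma digit_mapE j y : F j y = ((digit j)%:R + y) / b%:R.
Proof. by rewrite /ifs_map; ring. Qed.

Lemma digit_map_unit (j : 'I_#|W|) y : 0 <= y <= 1 -> 0 <= F j y <= 1.
Proof.
move=> /andP[y0 y1]; rewrite digit_mapE divr_ge0 ?addr_ge0 ?(ltW b_gt0)//=.
rewrite ler_pdivrMr ?b_gt0// mul1r.
have : (digit j)%:R + 1 <= b%:R :> R by rewrite natr1 ler_nat.
lra.
Qed.

Lemma digit_series_shift (w : nat -> 'I_b) n :
  series (fun i => (w i)%:R / b%:R ^+ i.+1 : R) n.+1 =
  ((w 0%N)%:R + series (fun i => (w i.+1)%:R / b%:R ^+ i.+1 : R) n) / b%:R.
Proof.
rewrite /series/= big_nat_recl// expr1 mulrDl mulr_suml; congr (_ + _).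
by apply: eq_bigr => i _; rewrite [in LHS]exprS invfM mulrA mulrAC.
Qed.

Lemma digit_series_unit (w : nat -> 'I_b) n :
  0 <= series (fun i => (w i)%:R / b%:R ^+ i.+1 : R) n <= 1.
Proof.
elim: n w => [|n IH] w; first by rewrite /series/= big_geq// lexx ler01.
have /andP[s0 s1] := IH (fun i => w i.+1); rewrite digit_series_shift.
rewrite divr_ge0 ?addr_ge0 ?(ltW b_gt0)//= ler_pdivrMr ?b_gt0// mul1r.
have : (w 0%N)%:R + 1 <= b%:R :> R by rewrite natr1 ler_nat.
lra.
Qed.

Lemma digit_series_limit_unit (w : nat -> 'I_b) (x : R) :
  series (fun i => (w i)%:R / b%:R ^+ i.+1 : R) @ \oo --> x -> 0 <= x <= 1.
Proof.
move=> wx; have <- := cvg_lim (@Rhausdorff R) wx.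
have cw : cvgn (series (fun i => (w i)%:R / b%:R ^+ i.+1 : R)).
  by apply/cvg_ex; exists x.
apply/andP; split.
  by apply: limr_ge => //; near=> n; case/andP: (digit_series_unit w n).
by apply: limr_le => //; near=> n; case/andP: (digit_series_unit w n).
Unshelve. all: by end_near. Qed.

(** The coding of a point of [A] reads off its digits, and the remainder after n digits is y_n / b^n
    with y_n in [0, 1]. *)
Lemma sub_missing_digit_set (A : set R) :
    (forall x, A x -> 0 <= x <= 1) ->
    (forall x, A x -> exists j, exists2 y, A y & x = F j y) ->
  A `<=` C.
Proof.
move=> A01 AF x Ax; split; first exact: A01.
have [j [y [y0 Ay yS]]] := coding AF Ax.
exists (fun n => enum_val (j n)); split => [n|]; first exact: enum_valP.
set u := (fun i : nat => _ : R).
have b0 := b_gt0.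
have xu n : x - series u n = y n / b%:R ^+ n.
  elim: n => [|n IH]; first by rewrite /series/= big_geq// subr0 expr0 divr1 y0.
  have -> : series u n.+1 = series u n + u n by rewrite /series/= big_nat_recr.
  rewrite opprD addrA IH yS digit_mapE /u exprS; field.
  by rewrite expf_neq0 gt_eqF.
apply/cvgrPdist_le => e e0.
have b1 : 0 <= (b%:R^-1 : R) < 1.
  by rewrite invr_ge0 ltW//= invf_lt1// ltr1n; lia.
have [N HN] := expr_le_eventually b1 e0.
exists N => // n /= Nn; rewrite xu; have /andP[yn0 yn1] := A01 _ (Ay n).
have bn0 : 0 <= b%:R ^+ n :> R by exact/exprn_ge0/ltW.
rewrite ger0_norm ?divr_ge0//; apply: le_trans (HN n Nn).
by rewrite exprVn ler_piMl// invr_ge0.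
Qed.

Lemma missing_digit_stable j x : C x -> C (F j x).
Proof.
move=> [x01 [w [wW wx]]]; split; first exact: digit_map_unit.
pose w' n := if n is m.+1 then w m else enum_val j.
exists w'; split => [[|n]|]; [exact: enum_valP|exact: wW|].
rewrite -cvg_shiftS /=.
rewrite [X in X @ _ --> _](_ : _ = (fun n =>
    ((digit j)%:R + series (fun i => (w i)%:R / b%:R ^+ i.+1 : R) n) / b%:R)).
  rewrite digit_mapE; apply: cvgMl; apply: cvgD => //; exact: cvg_cst.
by apply/funext => n; rewrite (digit_series_shift w').
Qed.

Lemma missing_digit_cover x : C x -> exists j, exists2 y, C y & x = F j y.
Proof.
move=> [x01 [w [wW wx]]].
exists (enum_rank_in (wW 0%N) (w 0%N)), (b%:R * x - (w 0%N)%:R); last first.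
  rewrite digit_mapE (enum_rankK_in (wW 0%N) (wW 0%N)).
  by field; rewrite gt_eqF ?b_gt0.
suff H : series (fun i => (w i.+1)%:R / b%:R ^+ i.+1 : R) @ \oo -->
    b%:R * x - (w 0%N)%:R.
  split; first exact: (@digit_series_limit_unit (fun n => w n.+1)).
  by exists (fun n => w n.+1); split => // n; exact: wW.
rewrite [X in X @ _ --> _](_ : _ = (fun n =>
    b%:R * series (fun i => (w i)%:R / b%:R ^+ i.+1 : R) n.+1 - (w 0%N)%:R)).
  apply: cvgB; last exact: cvg_cst.
  apply: cvgMr; move: wx; by rewrite -cvg_shiftS.
apply/funext => n; rewrite digit_series_shift mulrC divfK ?gt_eqF ?b_gt0//.
by rewrite addrC addKr.
Qed.

Lemma digit_map_continuous j : continuous (F j).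
Proof.
move=> x; rewrite [F j](_ : _ = fun y => ((digit j)%:R + y) / b%:R).
  apply: cvgMl; apply: cvgD; [exact: cvg_cst|exact: cvg_id].
by apply/funext => y; exact: digit_mapE.
Qed.

Lemma missing_digit_set_sub01 : C `<=` `[0, 1]%classic.
Proof. by move=> x [x01 _]; rewrite /= in_itv. Qed.

(** The union of the images of the closure [K] is closed and contains [C], hence contains [K]; so
    [K] is covered by its own images and consists of points with allowed digits. *)
Lemma missing_digit_set_closed : closed C.
Proof.
pose K := closure C.
have K01 : K `<=` `[0, 1]%classic.
  have /closure_id -> := @itv_closed _ R 0 1.
  exact: closure_subset missing_digit_set_sub01.
have cK : compact K.
  by apply: (subclosed_compact _ (@segment_compact R 0 1) K01); exact: closed_closure.
have KF : K `<=` \bigcup_j (F j @` K).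
  have /closure_id -> : closed (\bigcup_j (F j @` K)).
    apply: closed_bigcup; first exact: finite_finset.
    move=> j _; apply: compact_closed; first exact: norm_hausdorff.
    apply: continuous_compact => //; apply: continuous_subspaceT.
    exact: digit_map_continuous.
  apply: closure_subset => x /missing_digit_cover[j [y Cy ->]].
  by exists j => //; exists y => //; exact: subset_closure.
apply: sub_missing_digit_set => [x /K01|x /KF[j _ [y Ky <-]]].
  by rewrite /= in_itv.
by exists j, y.
Qed.

Hypothesis W_ge2 : (2 <= #|W|)%N.

Lemma missing_digit_attractor : is_attractor F C.
Proof.
split.
- have W0 : (0 < #|W|)%N by exact: ltn_trans W_ge2.
  (* The fixed point of one of the maps, whose digits are all equal. *)
  pose d : R := (digit (Ordinal W0))%:R / (b%:R - 1).
  have b1 : 0 < b%:R - 1 :> R by rewrite subr_gt0 ltr1n; lia.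
  exists d; apply: (@sub_missing_digit_set [set d]) => // x ->.
    rewrite divr_ge0 ?(ltW b1)//= ler_pdivrMr// mul1r lerBrDr natr1 ler_nat.
    exact: ltn_ord.
  exists (Ordinal W0), d => //; rewrite digit_mapE /d; field.
  by rewrite !gt_eqF// b_gt0.
- apply: (subclosed_compact missing_digit_set_closed (@segment_compact R 0 1)).
  exact: missing_digit_set_sub01.
- apply/seteqP; split => [x [j _ [y Cy <-]]|x /missing_digit_cover[j [y Cy ->]]].
    exact: missing_digit_stable.
  by exists j => //; exists y.
Qed.

End MissingDigits.

(** * Dimension of missing digit sets and the explicit gap *)

Section MissingDigitGap.
Context (R : realType) (b : nat) (W : {set 'I_b}).
Hypothesis b_ge3 : (3 <= b)%N.
Hypothesis W_ge2 : (2 <= #|W|)%N.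
Local Notation C := (missing_digit_set (R := R) W).
Local Notation digit j := (nat_of_ord (@enum_val _ (mem W) j)).
Local Notation F := (ifs_map (R := R) (fun _ : 'I_#|W| => 1)
  (fun j => Posz (digit j)) (fun _ => b)).
Local Notation Delta := (ln #|W|%:R / ln b%:R : R).

Let base_ge3 : 3 <= b%:R :> R.
Proof. by rewrite ler_nat. Qed.

Let b0 : 0 < b%:R :> R.
Proof. exact: lt_le_trans base_ge3. Qed.

Let attr : is_attractor F C := missing_digit_attractor R b_ge3 W_ge2.

Let F_unit (j : 'I_#|W|) : 1 = 1 :> int \/ 1 = -1 :> int.
Proof. by left. Qed.

Let F_ge2 (j : 'I_#|W|) : (2 <= b)%N.
Proof. by lia. Qed.

(** The leading entry is the most significant digit, as it is the outermost map in [foldr F x s]. *)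
Fixpoint digit_value (s : seq 'I_#|W|) : nat :=
  if s is j :: s' then (digit j * b ^ size s' + digit_value s')%N else 0%N.

Lemma digit_value_lt s : (digit_value s < b ^ size s)%N.
Proof.
elim: s => [|j s IH] /=; first by rewrite expn0.
rewrite expnS; apply: (@leq_trans ((digit j).+1 * b ^ size s)%N).
  by rewrite mulSn addnC ltn_add2r.
by rewrite leq_mul2r ltn_ord orbT.
Qed.

Lemma digit_value_inj s s' :
  size s = size s' -> digit_value s = digit_value s' -> s = s'.
Proof.
elim: s s' => [|j s IH] [|j' s'] //= [ss'] vv'.
have := digit_value_lt s; have := digit_value_lt s'; rewrite -ss' => lt' lt.
have dd' : digit j = digit j'.
  have /(congr1 (divn^~ (b ^ size s)%N)) := vv'.
  have bs0 : (0 < b ^ size s)%N by exact: leq_ltn_trans lt.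
  by rewrite -ss' !divnMDl// !divn_small// !addn0.
have -> : j = j' by apply/enum_val_inj/val_inj.
by congr (_ :: _); apply: IH => //; move: vv'; rewrite dd' -ss' => /addnI.
Qed.

Lemma foldr_digit_map s x :
  foldr F x s = ((digit_value s)%:R + x) / b%:R ^+ size s.
Proof.
elim: s => [|j s IH] /=; first by rewrite add0r expr0 divr1.
rewrite IH digit_mapE natrD natrM natrX exprS; field.
by rewrite expf_neq0// gt_eqF.
Qed.

Lemma dist_words_ge (k : nat) (s s' : k.-tuple 'I_#|W|) x : s != s' ->
  (b%:R ^+ k)^-1 <= `|foldr F x s - foldr F x s'|.
Proof.
move=> ss'; rewrite !foldr_digit_map !size_tuple.
rewrite -mulrBl opprD addrACA subrr addr0 mulrBl -natrX.
apply: (@dist_ratio_ge R (Posz _) (Posz _)); first by rewrite expn_gt0; lia.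
apply: contraNneq ss' => -[vv']; apply/eqP/val_inj.
by apply: digit_value_inj => //; rewrite !size_tuple.
Qed.

Lemma lnb_gt0 : 0 < ln b%:R :> R.
Proof. by rewrite ln_gt0//; have := base_ge3; lra. Qed.

Lemma Delta_gt0 : 0 < Delta.
Proof. by rewrite divr_gt0 ?lnb_gt0// ln_gt0// ltr1n. Qed.

Lemma powR_b_Delta : b%:R `^ Delta = #|W|%:R.
Proof.
rewrite /powR gt_eqF// divfK ?gt_eqF ?lnb_gt0// lnK// posrE ltr0n.
exact: ltn_trans W_ge2.
Qed.

Lemma powR_bX_Delta k : (b%:R ^+ k) `^ Delta = #|W|%:R ^+ k.
Proof.
rewrite -powR_mulrn ?(ltW b0)// -powRrM mulrC powRrM powR_b_Delta.
by rewrite powR_mulrn.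
Qed.

Lemma missing_digit_dist_le1 x y : C x -> C y -> `|x - y| <= 1.
Proof. by move=> [/andP[x0 x1] _] [/andP[y0 y1] _]; rewrite ler_norml; lra. Qed.

(** Above, |W| b^-(Delta + e) < 1 for each e > 0. Below, words of length k give |W|^k points of [C]
    that are b^-k apart, so the packing bound yields |W|^k <= A b^(kd) for all k, hence |W| <=
    b^d. *)
Lemma missing_digit_dim : hausdorff_dim C = Delta%:E.
Proof.
have b3 := base_ge3; have dimE := ifs_attractor_dim F_unit F_ge2 attr.
rewrite dimE; congr (_%:E); set d := fine _ in dimE *.
have b1 : 0 < (b%:R^-1 : R) < 1 by rewrite invr_gt0 b0 invf_lt1//; lra.
apply/eqP; rewrite eq_le; apply/andP; split.
  apply/ler_addgt0Pr => e e0; rewrite -lee_fin -dimE.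
  apply: (@hausdorff_dim_le R _ F C b%:R^-1 1) => //.
  - by move=> j x y; rewrite ifs_map_dist.
  - exact: attractor_cover attr.
  - exact: missing_digit_dist_le1.
  - exact: addr_gt0 Delta_gt0 e0.
  - rewrite card_ord -powR_inv1 ?(ltW b0)// -powRrM mulN1r powRN.
    rewrite ltr_pdivrMr ?powR_gt0// mul1r -[ltLHS]powR_b_Delta.
    have be : 1 < b%:R `^ e.
      by have := powR_lt_base e0 ler01 (_ : 1 < b%:R); rewrite powR1; apply; lra.
    by rewrite powRD ?(gt_eqF b0) ?implybT// ltr_pMr// powR_gt0.
have W0 : 0 < #|W|%:R :> R by rewrite ltr0n (ltn_trans _ W_ge2).
have bd0 : 0 < b%:R `^ d by exact: powR_gt0.
suff Wbd : #|W|%:R <= b%:R `^ d.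
  by rewrite ler_pdivrMr ?lnb_gt0// -ln_powR ler_ln ?posrE.
rewrite leNgt; apply/negP => bdW.
have [Q [D [Q2 D1 _ card]]] := ifs_separated_card F_unit F_ge2 attr.
have [c Cc] := let: And3 C0 _ _ := attr in C0.
pose A := (3 * (D * Q)) `^ d.
have DQ0 : 0 < 3 * (D * Q).
  by rewrite !mulr_gt0//; [exact: lt_le_trans D1|exact: lt_le_trans Q2].
have A0 : 0 < A by exact: powR_gt0.
have q01 : 0 <= b%:R `^ d / #|W|%:R < 1.
  by rewrite divr_ge0 ?(ltW bd0)//= ltr_pdivrMr// mul1r.
have A2 : 0 < (2 * A)^-1 by rewrite invr_gt0 mulr_gt0.
(* If b^d < |W|, this [k] makes A b^(kd) at most |W|^k / 2, against the packing bound. *)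
have [k /(_ _ (leqnn k))] := expr_le_eventually q01 A2.
apply/negP; rewrite -ltNge.
have bk1 : 1 <= b%:R ^+ k :> R by rewrite exprn_ege1//; lra.
have bk0 : 0 < b%:R ^+ k :> R by lra.
have : #|{: k.-tuple 'I_#|W|}|%:R <= (D * Q / (3 * b%:R ^+ k)^-1) `^ d.
  apply: (card _ (fun w : k.-tuple _ => foldr F c w)).
  - by rewrite invr_gt0 mulr_gt0//= invf_le1; lra.
  - by move=> w; apply: foldr_stable => //; exact: attractor_stable attr.
  - move=> w w' ww'; apply: le_trans (dist_words_ge c ww').
    by rewrite invfM mulrA divff ?mul1r// gt_eqF.
rewrite card_tuple card_ord natrX.
have -> : D * Q / (3 * b%:R ^+ k)^-1 = 3 * (D * Q) * b%:R ^+ k by rewrite invrK; ring.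
rewrite (powRM _ (ltW DQ0) (ltW bk0)) -/A.
have -> : (b%:R ^+ k) `^ d = (b%:R `^ d) ^+ k.
  by rewrite -(powR_mulrn _ (ltW b0)) -(powR_mulrn _ (ltW bd0)) -!powRrM mulrC.
have Wk0 : 0 < #|W|%:R ^+ k :> R by rewrite exprn_gt0.
rewrite -ler_pdivrMl// => le; rewrite exprMn exprVn ltr_pdivlMr//.
apply: lt_le_trans le; rewrite ltr_pM2r// ltf_pV2 ?posrE ?mulr_gt0//.
by lra.
Qed.

Lemma dist_same_word (k : nat) (s : k.-tuple 'I_#|W|) x y : C x -> C y ->
  `|foldr F x s - foldr F y s| <= (b%:R ^+ k)^-1.
Proof.
move=> Cx Cy; rewrite !foldr_digit_map !size_tuple -mulrBl opprD addrACA subrr add0r.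
have bk : 0 <= (b%:R ^+ k)^-1 :> R by rewrite invr_ge0 exprn_ge0// ltW.
by rewrite normrM [X in _ * X]ger0_norm// ler_piMl// missing_digit_dist_le1.
Qed.

(** From b^3 <= (b - 1)^5 the fifth power of the right side is at least |W|^3 >= 8, while (3/2)^5 <
    8. *)
Lemma powR_b_pred_Delta : 3 / 2 <= (b%:R - 1) `^ Delta.
Proof.
have b3 := base_ge3; pose x : R := b%:R - 1.
have b1 : 0 <= x by rewrite /x; lra.
have x5 : b%:R ^+ 3 <= x ^+ 5.
  apply: (@le_trans _ _ ((3 / 2 * x) ^+ 3)).
    by apply: lerXn2r; rewrite ?nnegrE /x; lra.
  rewrite exprMn (_ : x ^+ 5 = x ^+ 2 * x ^+ 3); last by rewrite -exprD.
  rewrite ler_wpM2r ?exprn_ge0//.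
  have : 2 <= x by rewrite /x; lra.
  by rewrite !exprS expr0; nra.
have := powR_le_base (ltW Delta_gt0) (exprn_ge0 3 (ltW b0)) x5.
rewrite powR_bX_Delta -(powR_mulrn _ b1) powRAC powR_mulrn ?powR_ge0//.
set P := x `^ Delta => WP; rewrite leNgt; apply/negP => P32.
have : P ^+ 5 <= (3 / 2) ^+ 5 by apply: lerXn2r; rewrite ?nnegrE ?powR_ge0 ?ltW.
have : 2 ^+ 3 <= #|W|%:R ^+ 3 :> R.
  by apply: lerXn2r; rewrite ?nnegrE ?ler_nat.
by move: WP; rewrite !exprS !expr0; lra.
Qed.

(* Take [k] with [b ^ k.-1 <= 2 v < b ^ k]. Among the first [#|W| ^ k + 1]
   points of the orbit two are near the same cylinder of length [b ^- k], and
   they differ by at least [1 / v]. The orbit expands by [b] at each step, so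
   only its last point can be at distance more than [1 / (2 b v)] from [C];
   this happens only if [(2 b v) `^ Delta < #|W| ^ k + 1], in which case
   [2 v < (b - 1) b ^ k.-1] and the cylinder is shorter. *)
Lemma missing_digit_gap (u : int) (v : nat) c :
    (0 < v)%N -> ~ C (u%:~R / v%:R) -> C c ->
  b%:R `^ (- ((2 * b%:R) `^ Delta * v%:R `^ Delta)) / (2 * v%:R) <
    `|c - u%:~R / v%:R|.
Proof.
move=> v0 nCx Cc; rewrite distrC ltNge; apply/negP => small.
have b3 := base_ge3.
have [|j [U [y [Uinj Cy yS Uy]]]] :=
  ifs_orbit F_unit F_ge2 (Q := b%:R) attr _ v0 nCx Cc; first by [].
have vR : 1 <= v%:R :> R by rewrite ler1n.
move: small; rewrite -powRM ?mulr_ge0 ?(ltW b0)//.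
set N := (2 * b%:R * v%:R) `^ Delta => small.
(* The word length is [k.+1] here, which is the [k] of the description above. *)
have [k bk] : exists k, (b ^ k <= 2 * v < b ^ k.+1)%N.
  by exists (trunc_log b (2 * v)); apply: trunc_log_bounds; lia.
have {bk} [bk1 bk2] : b%:R ^+ k <= 2 * v%:R :> R /\ 2 * v%:R < b%:R ^+ k.+1 :> R.
  by rewrite -natrM -!natrX ler_nat ltr_nat; apply/andP.
have [M ME] : exists M, M = (#|W| ^ k.+1)%N by eexists.
have powM : (b%:R ^+ k.+1) `^ Delta = M%:R by rewrite powR_bX_Delta ME natrX.
have bk0 : 0 < b%:R ^+ k :> R by rewrite exprn_gt0.
have MN : M%:R <= N.
  rewrite -powM; apply: powR_le_base; rewrite ?exprn_ge0 ?(ltW Delta_gt0) ?(ltW b0)//.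
  by rewrite (mulrC 2) -mulrA exprS ler_wpM2l// ltW.
pose g (n : 'I_M.+1) := map_tuple j (iota_tuple k.+1 n).
have [m [n [mn gmn]]] : exists m n : 'I_M.+1, (m < n)%N /\ g m = g n.
  apply: contrapT => no_pair.
  have /leq_card : injective g.
    move=> m n gmn; apply/val_inj/eqP; case: ltngtP => // lt; exfalso; apply: no_pair.
      by exists m, n.
    by exists n, m.
  by rewrite card_ord card_tuple card_ord -ME ltnn.
have word i l : y i = foldr F (y (i + l)%N) (map j (iota i l)).
  elim: l i => [|l IH] i /=; first by rewrite addn0.
  by rewrite yS IH addSnnS.
have ymn : `|y m - y n| <= (b%:R ^+ k.+1)^-1.
  have gE : map j (iota m k.+1) = map j (iota n k.+1) := congr1 val gmn.
  rewrite (word m k.+1) (word n k.+1) gE; exact: (dist_same_word (g n)).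
have w0 : 0 < (2 * v%:R)^-1 :> R by rewrite invr_gt0; lra.
have near i : `|(U i)%:~R / v%:R - y i| <= b%:R `^ (i%:R - N) * (2 * v%:R)^-1.
  apply: le_trans (Uy i) _; rewrite powRD ?(gt_eqF b0) ?implybT//.
  by rewrite powR_mulrn ?(ltW b0)// -mulrA ler_wpM2l// exprn_ge0// ltW.
have b1 : 1 <= b%:R :> R by lra.
(* m < n <= M <= N, so the earlier index has at least one expansion to spare. *)
have em : b%:R `^ (m%:R - N) <= b%:R^-1.
  rewrite -powR_inv1 ?(ltW b0)//; apply: ler_powR => //.
  have : m%:R + 1 <= M%:R :> R.
    by rewrite natr1 ler_nat; apply: leq_trans mn _; rewrite -ltnS.
  move: MN; lra.
have Umn : U m != U n by apply/eqP => /Uinj mnE; move: mn; rewrite mnE ltnn.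
have vw : v%:R^-1 = 2 * (2 * v%:R)^-1 :> R by field; lra.
have UmUn := dist_ratio_ge R v0 Umn; rewrite [leLHS]vw in UmUn.
move: UmUn; have := near m; have := near n.
have nM : n%:R <= M%:R :> R by rewrite ler_nat -ltnS.
set e := b%:R `^ (n%:R - N); pose t : R := 2 * v%:R / b%:R ^+ k.+1.
set x := (U n)%:~R / _; set x' := (U m)%:~R / v%:R => near_n near_m xx'.
(* In units of 1/(2v), the two orbit points are at least 2 apart, their distances to [y m] and [y n]
   are at most 1/b and [e], and the shared cylinder has length [t]. *)
suff lt2 : b%:R^-1 + e + t < 2.
  suff : 2 * (2 * v%:R)^-1 <= (b%:R^-1 + e + t) * (2 * v%:R)^-1.
    by rewrite ler_pM2r// leNgt lt2.
  apply: (le_trans xx').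
  have -> : x' - x = (x' - y m) + (y m - y n) - (x - y n) by ring.
  apply: le_trans (ler_normB _ _) _; apply: le_trans (lerD (ler_normD _ _) near_n) _.
  rewrite (mulrDl _ t) (mulrDl b%:R^-1) [leRHS]addrAC lerD2r; apply: lerD.
    by apply: le_trans near_m _; rewrite ler_wpM2r// ltW.
  by rewrite /t mulrAC divff ?mul1r//; lra.
have bV : b%:R^-1 <= 3^-1 :> R by rewrite lef_pV2 ?posrE.
have e1 : e <= 1 by rewrite -(powRr0 b%:R); apply: ler_powR => //; move: nM MN; lra.
have [NM|NM] := leP (M%:R + 1) N.
  have eb : e <= b%:R^-1.
    rewrite -powR_inv1 ?(ltW b0)//; apply: ler_powR => //; move: nM NM; lra.
  have : t < 1 by rewrite ltr_pdivrMr ?exprn_gt0// mul1r.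
  by move: eb bV; lra.
(* Here N < M + 1 and only e <= 1 is known. A larger [t] would mean (b - 1) b^k <= 2v, hence N >= (b
   - 1)^Delta M >= 3M/2 >= M + 1. *)
suff : t < 1 - b%:R^-1 by move: e1; lra.
have -> : 1 - b%:R^-1 = (b%:R - 1) * b%:R ^+ k / b%:R ^+ k.+1 :> R.
  by rewrite exprS; field; rewrite expf_neq0 gt_eqF.
rewrite ltr_pM2r ?invr_gt0 ?exprn_gt0// ltNge; apply/negP => big.
have M2 : 2 <= M%:R :> R.
  rewrite ler_nat ME expnS; apply: leq_trans W_ge2 _.
  by rewrite leq_pmulr// expn_gt0 (ltn_trans _ W_ge2).
have : (b%:R - 1) `^ Delta * M%:R <= N.
  have bb : 0 <= b%:R - 1 :> R by lra.
  rewrite -powM -powRM ?exprn_ge0 ?(ltW b0)//; apply: powR_le_base.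
  - exact: ltW Delta_gt0.
  - by rewrite mulr_ge0// exprn_ge0// ltW.
  - by rewrite (mulrC 2) -mulrA exprS mulrCA ler_wpM2l// ltW.
have := powR_b_pred_Delta; set P := _ `^ Delta; nra.
Qed.

End MissingDigitGap.

(** * Finiteness of the set of solutions *)

Lemma finite_rational_box (n : nat) (S : set (int * nat)) :
  (forall uv, S uv -> (`|uv.1| <= n)%N /\ (uv.2 <= n)%N) -> finite_set S.
Proof.
move=> Sn; pose A := (fun k : nat => Posz k - Posz n) @` `I_(n + n).+1.
apply: (@sub_finite_set _ _ (A `*` `I_n.+1)).
  move=> [u v] /Sn[/= un vn]; split => //=.
  by exists (absz (u + Posz n)) => /=; lia.
by apply: finite_setX; [exact/finite_image/finite_II|exact: finite_II].
Qed.

(** With h = v^(d/2), the logarithm of the left side is quadratic in [h], while ln v < (2/d) h makes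
    that of the right side at most linear; so h < B. *)
Lemma powR_lt_linear_bounded (R : realType) (a g d : R) : 1 < a -> 0 < g -> 0 < d ->
  exists n : nat, forall v : nat,
    (0 < v)%N -> a `^ (g * v%:R `^ d) < 2 * v%:R -> (v <= n)%N.
Proof.
move=> a1 g0 d0; have lna : 0 < ln a by exact: ln_gt0.
pose B := (ln 2 + 2 / d) / (g * ln a).
have ln2 : 0 < ln 2 :> R by rewrite ln_gt0// ltr1n.
exists (Num.truncn (B `^ (2 / d))) => v v0 av; rewrite truncn_ge_nat ?powR_ge0//.
have v1 : 1 <= v%:R :> R by rewrite ler1n.
pose h := v%:R `^ (d / 2) : R.
have dd : d / 2 * (2 / d) = 1 by field; rewrite gt_eqF.
have h1 : 1 <= h.
  by rewrite -(powRr0 v%:R); apply: ler_powR => //; rewrite divr_ge0// ltW.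
have hv : v%:R = h `^ (2 / d) by rewrite -powRrM dd powRr1//; lra.
have hz : v%:R `^ d = h * h.
  rewrite -powRD; first by congr (_ `^ _); field.
  by apply/implyP => _; rewrite gt_eqF//; lra.
have lnv : ln v%:R < 2 / d * h.
  by rewrite hv ln_powR ltr_pM2l ?divr_gt0//; apply: ln_sublinear; lra.
have : g * (h * h) * ln a < ln 2 + ln v%:R.
  by rewrite -hz -ln_powR -lnM ?posrE ?ltr_ln ?posrE ?powR_gt0 ?mulr_gt0//; lra.
move=> lt; rewrite hv; apply: powR_le_base; rewrite ?divr_ge0 ?(ltW d0)//; first lra.
rewrite /B ler_pdivlMr ?mulr_gt0//.
have d2 : 0 < 2 / d by rewrite divr_gt0.
move: lt lnv ln2 d2; move: (2 / d) (ln 2) (ln v%:R) => e l lv lt lnv l0 e0.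
have : g * ln a * h * h < (l + e) * h by nra.
by rewrite ltr_pM2r; [move=> /ltW; rewrite mulrC|lra].
Qed.

Theorem theorem3p4 (R : realType) :
  (forall (J : nat) (p r : 'I_J -> int) (q : 'I_J -> nat) (C : set R),
      (2 <= J)%N ->
      (forall j, p j = 1 \/ p j = -1) ->
      (forall j, (2 <= q j)%N) ->
      is_attractor (ifs_map (R := R) p r q) C ->
      open_set_condition (ifs_map (R := R) p r q) ->
      let Delta : R := fine (hausdorff_dim C) in
      exists rho0 : R, forall rho : R, rho0 <= rho ->
        forall (u : int) (v : nat), (1 <= v)%N ->
          ~ C (u%:~R / v%:R) ->
          expR (- (rho * v%:R `^ Delta)) < set_dist C [set u%:~R / v%:R])
  /\
  (forall (b : nat) (W : {set 'I_b}),
      (3 <= b)%N -> (2 <= #|W| <= b - 1)%N ->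
      let C : set R := missing_digit_set (R := R) W in
      let Delta : R := ln #|W|%:R / ln b%:R in
      [/\ hausdorff_dim C = Delta%:E,
          forall (u : int) (v : nat), (1 <= v)%N ->
            ~ C (u%:~R / v%:R) ->
            b%:R `^ (- ((2 * b%:R) `^ Delta * v%:R `^ Delta)) / (2 * v%:R)
              < set_dist C [set u%:~R / v%:R]
        & forall xi delta : R, C xi -> (2 * b%:R) `^ Delta < delta ->
            finite_set [set uv : int * nat |
              [/\ (1 <= uv.2)%N, ~ C (uv.1%:~R / uv.2%:R)
                & `|xi - uv.1%:~R / uv.2%:R|
                    <= b%:R `^ (- (delta * uv.2%:R `^ Delta))]]]).
Proof.
split; first exact: ifs_dist_lower_bound.
move=> b W b3 /andP[W2 _] C Delta.
have [C0 cC _] := missing_digit_attractor R b3 W2.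
split; first exact: missing_digit_dim.
  move=> u v v0 nCx; have [c Cc ->] := set_dist_attained (u%:~R / v%:R) cC C0.
  exact: missing_digit_gap.
move=> xi delta Cxi delta_gt.
have b1 : 1 < b%:R :> R by rewrite ltr1n; lia.
have g0 : 0 < delta - (2 * b%:R) `^ Delta by rewrite subr_gt0.
have [n vn] := powR_lt_linear_bounded b1 g0 (Delta_gt0 R b3 W2).
apply: (@finite_rational_box (2 * n)) => -[u v] [/= v0 nCx close].
have vR : 1 <= v%:R :> R by rewrite ler1n.
have v_le : (v <= n)%N.
  (* Comparing the gap with the assumed approximation leaves b^((delta - (2b)^Delta) v^Delta) <
     2v. *)
  apply: vn => //.
  have := lt_le_trans (missing_digit_gap b3 W2 v0 nCx Cxi) close.
  rewrite ltr_pdivrMr; last lra.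
  have bn0 : (b%:R : R) != 0 by rewrite gt_eqF//; lra.
  rewrite mulrBl powRB; last by rewrite bn0 implybT.
  by rewrite !powRN [ltRHS]mulrC ltr_pdivlMr ?powR_gt0 ?(lt_trans ltr01)// mulrC.
split; last by lia.
have xi1 : `|xi| <= 1 by case: Cxi => /andP[x0 x1] _; rewrite ger0_norm.
(* The numerator is bounded through |u/v| <= |xi| + 1 <= 2, so |u| <= 2v <= 2n. *)
have close1 : `|xi - u%:~R / v%:R| <= 1.
  apply: (le_trans close); rewrite -[leRHS](powRr0 b%:R).
  apply: ler_powR; rewrite ?(ltW b1)// oppr_le0 mulr_ge0 ?powR_ge0//.
  by apply: ltW; apply: le_lt_trans delta_gt; exact: powR_ge0.
have x2 : `|u%:~R / v%:R : R| <= 2.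
  have := ler_normB xi (xi - u%:~R / v%:R); rewrite subKr; lra.
rewrite -(ler_nat R) natr_absz intr_norm natrM.
have nv : v%:R <= n%:R :> R by rewrite ler_nat.
move: x2; rewrite normrM [X in _ * X]ger0_norm ?invr_ge0//.
by rewrite ler_pdivrMr; lra.
Qed.
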